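(* Let $X$ be a real Banach space, let $f: X \to \mathbb{R}\cup\{+\infty\}$ be a proper lower semicontinuous convex function, let $\ell\geq 0$ and let $S\subset X$ be a nonempty set such that $\overline{S}\subset\operatorname{dom}f$. Consider the following statements: (a) $\partial f(x)\cap \ell\mathbb{B}^*\neq\emptyset$ for all $x\in\operatorname{bd}(S)$; (b) $f$ is $\ell$-Lipschitz on $S$. If $S$ is bounded, then (a) implies (b). Conversely, if $S$ is open, then (b) implies (a).
   Context: $X^*$ is the continuous dual of $X$ with its dual norm, $\mathbb{B}^*$ is the closed unit ball of $X^*$ (so $\ell\mathbb{B}^*=\{x^*\in X^*:\|x^*\|\le \ell\}$). $\overline{S}$ and $\operatorname{bd}(S)$ are the closure and boundary of $S$ in the norm topology of $X$. For $f:X\to\mathbb{R}\cup\{+\infty\}$, $\operatorname{dom}f=\{x\in X: f(x)\in\mathbb{R}\}$; $f$ is proper if $\operatorname{dom} f\neq\emptyset$, convex (resp. lower semicontinuous) if its epigraph $\{(x,r)\in X\times\mathbb{R}: f(x)\le r\}$ is convex (resp. closed in $X\times\mathbb{R}$). $f$ is $\ell$-Lipschitz on a nonempty set $S\subset X$ if $f$ is finite on $S$ and $|f(x)-f(y)|\le \ell\|x-y\|$ for all $x,y\in S$. The subdifferential of $f$ at $x$ with $f(x)$ finite is $\partial f(x)=\{x^*\in X^*: f(y)-f(x)\ge\langle x^*,y-x\rangle\ \forall y\in X\}$. *)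

(* Defs.v *)
From HB Require Import structures.
From mathcomp Require Import all_boot all_order all_algebra.
From mathcomp Require Import all_classical all_reals all_analysis.

Set Implicit Arguments.
Unset Strict Implicit.
Unset Printing Implicit Defensive.

Import Order.TTheory GRing.Theory Num.Theory.
Import numFieldNormedType.Exports.

Local Open Scope classical_set_scope.
Local Open Scope ring_scope.

(* The scalar field is written R^o where it has to be seen as a normed module
   over itself. *)

Record continuous_dual (R : realType) (X : normedModType R) := ContinuousDual {
  dual_linear :> {linear X -> R^o};
  dual_continuous : continuous dual_linear
}.

(* The supremum is taken in R: the set is nonempty, and it is bounded above
   because x' is continuous. *)
Definition dual_norm (R : realType) (X : normedModType R)
    (x' : continuous_dual X) : R :=
  sup [set `|x' x| | x in [set x : X | `|x| <= 1]].

Definition dual_ball (R : realType) (X : normedModType R) (l : R) :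
    set (continuous_dual X) :=
  [set x' | dual_norm x' <= l].

Definition boundary (T : topologicalType) (S : set T) : set T :=
  closure S `\` interior S.

Section extended_real_valued.
Variables (R : realType) (X : normedModType R).
Implicit Types (f : X -> \bar R) (S : set X) (l : R).

Definition edom f : set X := [set x | f x \is a fin_num].

Definition eproper f : Prop := edom f !=set0.

Definition epigraph f : set (X * R^o)%type := [set p | (f p.1 <= p.2%:E)%E].

Definition econvex f : Prop := convex_set (epigraph f).

Definition elsc f : Prop := closed (epigraph f).

(* Outside of the domain of f, where f x is infinite, fine (f x) is 0: hence the
   first conjunct. *)
Definition elipschitz l f S : Prop :=
  S `<=` edom f /\ l.-lipschitz_S (fine \o f : X -> R^o).

(* Empty outside of the domain of f. *)
Definition subdifferential f (x : X) : set (continuous_dual X) :=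
  [set x' | f x \is a fin_num /\
            forall y, ((x' (y - x))%:E <= f y - f x)%E].

End extended_real_valued.

(* Main.v *)
Require Import Defs.
From HB Require Import structures.
From mathcomp Require Import all_boot all_order all_algebra.
From mathcomp Require Import all_classical all_reals all_analysis.
From mathcomp Require Import ring lra.

Set Implicit Arguments.
Unset Strict Implicit.
Unset Printing Implicit Defensive.

Import Order.TTheory GRing.Theory Num.Theory.
Import numFieldNormedType.Exports.

Local Open Scope classical_set_scope.
Local Open Scope ring_scope.

(** Both implications are one-sided slope estimates.

From (a) to (b): prolong the segment from [x] to [y] up to the supremum [z] of
the points of this ray that are in [S]. It exists because [S] is bounded, lies
at [y] or beyond, and is a boundary point ([bounded_ray_boundary]). A
subgradient at [z] of norm at most [l] bounds the slope of [f] from [x] to [z]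
by [l], and by convexity the slope from [x] to [y] is not larger
([boundary_subgradients_bound]).

From (b) to (a): near a point [w] of the open set [S], the Lipschitz estimate
holds along the beginning of every segment that starts at [w], so by convexity
[f z >= f w - l * `|z - w|] for every [z] in [X]. Since the epigraph is closed,
this passes to the points [x] of the closure of [S] ([lipschitz_slope_lower]).
The cone generated by the epigraph of [f], seen from [(x, f x)], therefore lies
above the concave function [v |-> - (l * `|v|)], and the Hahn-Banach theorem
separates the two by a linear functional, which is at once a subgradient of [f]
at [x] and bounded by [l] ([convex_cone_supported]).

The Hahn-Banach theorem is proved for sublinear functionals on a real vector
space, with Zorn's lemma applied to the sublinear functionals themselves: a
minimal one is linear ([sublinear_majorizes_linear]). *)

(** * Sublinear functionals and the Hahn-Banach theorem *)

Section sublinear.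
Variables (R : realType) (X : lmodType R).
Implicit Types (p q : X -> R) (A : X -> set R).

(** An inequality for positive factors suffices: applied to [s] and to its
inverse it gives positive homogeneity, see [sublinearZ]. *)
Definition sublinear q : Prop :=
  (forall x y, q (x + y) <= q x + q y) /\
  (forall (s : R) x, 0 < s -> q (s *: x) <= s * q x).

Lemma sublinearZ q (s : R) x : sublinear q -> 0 <= s -> q (s *: x) = s * q x.
Proof.
move=> [_ qZ]; rewrite le0r => /predU1P[->|s_gt0].
  rewrite scale0r mul0r; apply/eqP; rewrite eq_le.
  have := qZ 2^-1 0; have := qZ 2 0.
  rewrite !scaler0 invr_gt0 ltr0n => /(_ isT) ? /(_ isT); lra.
apply/eqP; rewrite eq_le; apply/andP; split; first exact: qZ.
rewrite -ler_pdivlMl// -{1}[x](scalerK (lt0r_neq0 s_gt0)).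
by apply: qZ; rewrite invr_gt0.
Qed.

Lemma sublinear_opp q x : sublinear q -> - q (- x) <= q x.
Proof.
move=> q_sub; have q0 := sublinearZ 0 q_sub (lexx 0).
have := q_sub.1 x (- x); rewrite subrr -(scale0r 0) q0; lra.
Qed.

(** Every sublinear functional constructed below is a pointwise infimum: of the
members of a chain, of the increments of a functional along a half-line, of
penalized heights over a cone. *)
Lemma sublinear_inf A :
  (forall x, A x !=set0) -> (forall x, has_lbound (A x)) ->
  (forall x y a b, A x a -> A y b -> exists2 c, A (x + y) c & c <= a + b) ->
  (forall (s : R) x a, 0 < s -> A x a ->
    exists2 c, A (s *: x) c & c <= s * a) ->
  sublinear (fun x => inf (A x)).
Proof.
move=> A0 Alb AD AZ; split=> [x y|s x s_gt0].
  rewrite -lerBlDr; apply: lb_le_inf => // a Axa.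
  rewrite lerBlDr -lerBlDl; apply: lb_le_inf => // b Ayb.
  rewrite lerBlDl; have [c Ac] := AD _ _ _ _ Axa Ayb.
  exact/le_trans/ge_inf.
rewrite -ler_pdivrMl//; apply: lb_le_inf => // a Axa.
rewrite ler_pdivrMl//; have [c Ac] := AZ _ _ _ s_gt0 Axa.
exact/le_trans/ge_inf.
Qed.

(** The functional [h |-> inf_(t >= 0) (q (h + t *: x) - t * q x)] is sublinear
and below [q], hence equal to [q] by minimality; at [- x] the term [t = 1] of
the infimum is [- q x]. *)
Lemma minimal_sublinear_odd q : sublinear q ->
    (forall r, sublinear r -> (forall x, r x <= q x) -> r = q) ->
  forall x, q (- x) = - q x.
Proof.
move=> q_sub q_min x.
pose A h := [set q (h + t *: x) - t * q x | t in [set t | 0 <= t]].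
have Alb h : lbound (A h) (- q (- h)).
  move=> _ [t t_ge0 <-]; rewrite lerBrDr -(sublinearZ _ q_sub t_ge0).
  have := q_sub.1 (h + t *: x) (- h); rewrite addrAC subrr add0r; lra.
have Ahlb h : has_lbound (A h) by exists (- q (- h)).
have Aq h : A h (q h).
  by exists 0; rewrite /= ?lexx// scale0r addr0 mul0r subr0.
have A_sub : sublinear (fun h => inf (A h)).
  apply: sublinear_inf => //; first by move=> h; exists (q h).
    move=> h k _ _ [s /= s_ge0 <-] [t /= t_ge0 <-].
    exists (q (h + k + (s + t) *: x) - (s + t) * q x).
      by exists (s + t) => //=; rewrite addr_ge0.
    have := q_sub.1 (h + s *: x) (k + t *: x).
    by rewrite scalerDl addrACA; lra.
  move=> s h _ s_gt0 [t /= t_ge0 <-].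
  exists (q (s *: h + (s * t) *: x) - (s * t) * q x).
    by exists (s * t) => //=; rewrite mulr_ge0// ltW.
  by rewrite -scalerA -scalerDr (sublinearZ _ q_sub (ltW s_gt0)) mulrBr mulrA.
have qE := q_min _ A_sub (fun h => ge_inf (Ahlb h) (Aq h)).
have : q (- x) <= - q x.
  rewrite -{1}qE; apply: ge_inf => //; exists 1; first exact: ler01.
  rewrite scale1r mul1r addNr -(scale0r 0) (sublinearZ _ q_sub)//.
  by rewrite mul0r sub0r.
have := sublinear_opp x q_sub; lra.
Qed.

(** Zorn's lemma for the reversed pointwise order: the infimum over a chain is
finite, because every sublinear [q <= p] satisfies [q h >= - p (- h)]. *)
Lemma minimal_sublinear_exists p : sublinear p ->
  exists q, [/\ sublinear q, forall x, q x <= p x &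
    forall r, sublinear r -> (forall x, r x <= q x) -> r = q].
Proof.
move=> p_sub.
pose T := {q : X -> R | sublinear q /\ forall x, q x <= p x}.
pose below (q r : T) := `[< forall x, sval r x <= sval q x >].
have [| | | |[q [q_sub qp]] q_min] := @Zorn T below.
- by move=> q; apply/asboolP.
- move=> q r s /asboolP qr /asboolP rs; apply/asboolP => x.
  exact: le_trans (rs x) (qr x).
- move=> [q qP] [r rP] /asboolP/= qr /asboolP/= rq.
  apply/eq_exist/funext => x.
  by apply/eqP; rewrite eq_le; apply/andP; split; [exact: rq|exact: qr].
- move=> C C_tot.
  (* With [p] adjoined, the chain is nonempty and still totally ordered. *)
  pose pT : T := exist _ p (conj p_sub (fun x => lexx (p x))).
  pose D := pT |` C.
  have pT_below r : below pT r by apply/asboolP; exact: (svalP r).2.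
  have D_tot : total_on D below.
    move=> q r [->|Cq] [->|Cr]; rewrite ?pT_below; [by left|by left|by right|].
    exact: C_tot.
  pose A h := [set sval q h | q in D].
  have A0 h : A h !=set0 by exists (p h), pT => //; left.
  have Alb h : has_lbound (A h).
    exists (- p (- h)) => _ [q _ <-]; have [q_sub qp] := svalP q.
    by rewrite (le_trans _ (sublinear_opp _ q_sub))// lerN2.
  have A_sub : sublinear (fun h => inf (A h)).
    apply: sublinear_inf => //
      [x y _ _ [q Dq <-] [r Dr <-]|s x _ s_gt0 [q Dq <-]].
      have [/asboolP qr|/asboolP rq] := D_tot _ _ Dq Dr.
        exists (sval r (x + y)); first by exists r.
        by rewrite (le_trans ((svalP r).1.1 _ _))// lerD2r.
      exists (sval q (x + y)); first by exists q.
      by rewrite (le_trans ((svalP q).1.1 _ _))// lerD2l.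
    exists (sval q (s *: x)); first by exists q.
    exact: (svalP q).1.2.
  have Ap h : inf (A h) <= p h by apply: ge_inf => //; exists pT => //; left.
  exists (exist _ (fun h => inf (A h)) (conj A_sub Ap)) => q Cq.
  apply/asboolP => x /=.
  by apply: ge_inf => //; exists q => //; right.
exists q; split=> // r r_sub rq.
have rp x : r x <= p x by exact: le_trans (rq x) (qp x).
by have /(congr1 sval) := q_min (exist _ r (conj r_sub rp)) (asboolT rq).
Qed.

(** A sublinear functional that is odd is additive, since subadditivity at
[- x] and [- y] is the reverse inequality at [x] and [y]. *)
Lemma sublinear_majorizes_linear p : sublinear p ->
  exists F : {linear X -> R^o}, forall x, F x <= p x.
Proof.
move=> /minimal_sublinear_exists[q [q_sub qp q_min]].
have qN := minimal_sublinear_odd q_sub q_min.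
have qD x y : q (x + y) = q x + q y.
  apply/eqP; rewrite eq_le; apply/andP; split; first exact: q_sub.1.
  by have := q_sub.1 (- x) (- y); rewrite -opprD !qN; lra.
have q_lin : linear (q : X -> R^o).
  move=> a x y; rewrite qD; congr (_ + _).
  have [a_ge0|a_lt0] := leP 0 a; first exact: sublinearZ.
  rewrite -[a]opprK scaleNr qN sublinearZ ?oppr_ge0 ?ltW//.
  by rewrite scaleNr.
pose q_isLinear := GRing.isLinear.Build _ _ _ _ _ q_lin.
pose F : {linear X -> R^o} := HB.pack (q : X -> R^o) q_isLinear.
by exists F.
Qed.

End sublinear.

(** * Supporting functionals of bounded norm *)

Section dual.
Variables (R : realType) (X : normedModType R).
Implicit Types (phi : continuous_dual X) (K : set (X * R)) (l : R).

Lemma dual_norm_ge phi x : `|phi x| <= dual_norm phi * `|x|.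
Proof.
have [->|x_neq0] := eqVneq x 0; first by rewrite linear0 !normr0 mulr0.
have nx_gt0 : 0 < `|x| by rewrite normr_gt0.
have [M M_bound] : exists M, forall y, `|y| <= 1 -> `|phi y| <= M.
  have := @dual_continuous _ _ phi.
  by move=> /linear_bounded_continuous/bounded_funP/(_ 1).
rewrite -ler_pdivrMr// mulrC -[`|x|^-1]gtr0_norm ?invr_gt0// -normrM.
have -> : `|x|^-1 * phi x = phi (`|x|^-1 *: x) by rewrite linearZ_LR.
apply: ub_le_sup.
  by exists M => _ [y /= y1 <-]; exact: M_bound.
exists (`|x|^-1 *: x) => //=.
by rewrite normrZ gtr0_norm ?invr_gt0// mulVf// gt_eqF.
Qed.

Lemma linear_bounded_dual_ball l (F : {linear X -> R^o}) : 0 <= l ->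
  (forall x, F x <= l * `|x|) ->
  exists2 phi : continuous_dual X, dual_ball l phi & dual_linear phi = F.
Proof.
move=> l_ge0 Fl.
have nFl x : `|F x| <= l * `|x|.
  by rewrite ler_norml Fl andbT lerNl -linearN (le_trans (Fl _))// normrN.
have F_cont : continuous F.
  apply/linear_bounded_continuous/bounded_funP => r; exists (l * r) => x xr.
  by rewrite (le_trans (nFl x))// ler_wpM2l.
exists (ContinuousDual F_cont) => //.
apply: ge_sup; first by exists `|F 0|, 0 => //=; rewrite normr0.
move=> _ [x /= x1 <-]; apply: le_trans (nFl x) _.
by rewrite -[leRHS]mulr1 ler_wpM2l.
Qed.

(** The infimum [p h] of [u.2 + l * `|h - u.1|] over [u] in [K] is sublinear
because [K] is a convex cone, and finite because [K] is above [- (l * `|.|)].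
A linear functional below [p] is below [l * `|.|], by the term [u = (0, 0)],
and below [K], by the term with [u.1 = h]. *)
Lemma convex_cone_supported K l : 0 <= l -> K (0, 0) ->
  (forall u v, K u -> K v -> K (u.1 + v.1, u.2 + v.2)) ->
  (forall (s : R) u, 0 < s -> K u -> K (s *: u.1, s * u.2)) ->
  (forall u, K u -> - (l * `|u.1|) <= u.2) ->
  exists2 phi : continuous_dual X, dual_ball l phi &
    forall u, K u -> phi u.1 <= u.2.
Proof.
move=> l_ge0 K0 KD KZ Kl.
pose A h : set R := [set u.2 + l * `|h - u.1| | u in K].
have Al h : A h (l * `|h|).
  by exists (0, 0) => //=; rewrite add0r subr0.
have Alb h : has_lbound (A h).
  exists (- (l * `|h|)) => _ [u Ku <-].
  have := Kl _ Ku; have : `|u.1| <= `|h| + `|h - u.1|.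
    by rewrite -[u.1 in leLHS](subKr h); exact: ler_normB.
  by move=> /(ler_wpM2l l_ge0); rewrite mulrDr; lra.
have A_sub : sublinear (fun h => inf (A h)).
  apply: sublinear_inf => //; first by move=> h; exists (l * `|h|).
    move=> h k _ _ [u Ku <-] [v Kv <-].
    exists (u.2 + v.2 + l * `|h + k - (u.1 + v.1)|).
      by exists (u.1 + v.1, u.2 + v.2) => //; exact: KD.
    rewrite opprD addrACA [leRHS]addrACA lerD2l -mulrDr.
    exact/ler_wpM2l/ler_normD.
  move=> s h _ s_gt0 [u Ku <-].
  exists (s * u.2 + l * `|s *: h - s *: u.1|).
    by exists (s *: u.1, s * u.2) => //; exact: KZ.
  by rewrite -scalerBr normrZ gtr0_norm// mulrDr mulrCA.
have [F Fp] := sublinear_majorizes_linear A_sub.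
have FA h a : A h a -> F h <= a.
  by move=> Aa; apply: le_trans (Fp h) _; exact: ge_inf.
have [phi phil phiF] := linear_bounded_dual_ball l_ge0 (fun h => FA _ _ (Al h)).
exists phi => // u Ku; rewrite phiF; apply: FA; exists u => //.
by rewrite subrr normr0 mulr0 addr0.
Qed.

End dual.

(** * Slopes of convex functions *)

Section convex.
Variables (R : realType) (X : normedModType R).
Implicit Types (f : X -> \bar R) (S : set X) (l : R).

Lemma econvex_le f y z (r s t : R) : econvex f -> 0 <= t -> t <= 1 ->
  (f y <= r%:E)%E -> (f z <= s%:E)%E ->
  (f (z + t *: (y - z))%R <= (s + t * (r - s))%:E)%E.
Proof.
move=> f_convex t_ge0 t_le1 yr zs.
have -> : z + t *: (y - z) = t *: y + (1 - t) *: z.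
  by rewrite scalerBr scalerBl scale1r addrCA.
have -> : s + t * (r - s) = t * r + (1 - t) * s by ring.
have := f_convex (y, r : R^o) (z, s : R^o) (Itv01 t_ge0 t_le1).
by rewrite !inE => /(_ yr zs).
Qed.

(** Take the supremum of the parameters at which the ray is in [S]: if the point
were interior to [S], the ray would still be in [S] slightly further. *)
Lemma bounded_ray_boundary S x u : bounded_set S -> u != 0 -> S (x + u) ->
  exists2 t, 1 <= t & boundary S (x + t *: u).
Proof.
move=> [M [_ /(_ (M + 1))]]; rewrite ltrDl => /(_ ltr01) SM u_neq0 Su.
pose ray (t : R^o) : X := x + t *: u.
have ray_cont : continuous ray.
  by move=> t; apply: cvgD; [exact: cvg_cst|exact: cvgZr_tmp].
pose T := ray @^-1` S.
have T1 : T 1 by rewrite /T /ray /= scale1r.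
have T_ub : has_ubound T.
  exists ((M + 1 + `|x|) / `|u|) => t /SM.
  rewrite ler_pdivlMr ?normr_gt0// => rayM.
  apply: le_trans (ler_wpM2r _ (ler_norm t)) _ => //.
  rewrite -normrZ -[t *: u](addKr x) addrC.
  by apply: le_trans (ler_normB _ _) _; rewrite lerD2r.
exists (sup T); first exact: ub_le_sup.
split=> [B /ray_cont rayB|].
  have [t [Tt Bt]] := closure_sup (ex_intro _ _ T1) T_ub rayB.
  by exists (ray t).
move=> /ray_cont/nbhs_ballP[e /= e_gt0 ball_T].
suff /(ub_le_sup T_ub) : T (sup T + e / 2) by rewrite gerDl; lra.
apply: ball_T; rewrite /= /ball/= opprD addrA subrr sub0r normrN.
by rewrite gtr0_norm ?divr_gt0//; lra.
Qed.

(** With [z = x + t *: (y - x)] on the boundary and [t >= 1], the subgradient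
inequality at [z] is tested at [x], behind [z]: it bounds [f z - f x] from
above, and convexity on the segment from [x] to [z] brings the bound to [y]. *)
Lemma boundary_subgradients_bound f S l x y :
    econvex f -> closure S `<=` edom f -> bounded_set S ->
    (forall z, boundary S z -> subdifferential f z `&` dual_ball l !=set0) ->
    S x -> S y ->
  fine (f y) - fine (f x) <= l * `|y - x|.
Proof.
move=> f_convex S_dom S_bnd sub_l Sx Sy.
have [->|yx] := eqVneq y x; first by rewrite !subrr normr0 mulr0.
have u_neq0 : y - x != 0 by rewrite subr_eq0.
have [|t t_ge1] := bounded_ray_boundary (x := x) S_bnd u_neq0.
  by rewrite addrC subrK.
set z := x + _ => bz; have t_gt0 : 0 < t by rewrite (lt_le_trans ltr01).
have [phi [[/fineK fz phi_sub] phi_l]] := sub_l _ bz.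
have fx := fineK (S_dom _ (subset_closure Sx)).
have fy := fineK (S_dom _ (subset_closure Sy)).
have slope : fine (f z) - fine (f x) <= t * phi (y - x).
  have := phi_sub x; rewrite -fx -fz -EFinB lee_fin.
  have -> : x - z = (- t) *: (y - x).
    by rewrite /z opprD addrA subrr sub0r scaleNr.
  by rewrite linearZ_LR; rewrite /GRing.scale/= mulNr; lra.
have phi_u : phi (y - x) <= l * `|y - x|.
  apply: le_trans (ler_norm _) _; apply: le_trans (dual_norm_ge _ _) _.
  exact: ler_wpM2r.
have yE : y = x + t^-1 *: (z - x).
  by rewrite /z addrAC subrr add0r scalerA mulVf ?gt_eqF// scale1r addrC subrK.
have ti_ge0 : 0 <= t^-1 by rewrite invr_ge0 ltW.
have ti_le1 : t^-1 <= 1 by rewrite invf_le1.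
have := econvex_le (y := z) (z := x) (r := fine (f z)) (s := fine (f x))
  f_convex ti_ge0 ti_le1.
rewrite fx fz -yE -fy lee_fin => /(_ (lexx _) (lexx _)).
rewrite -lerBlDl => /le_trans; apply.
rewrite ler_pdivrMl//; apply: le_trans slope _.
by rewrite ler_pM2l.
Qed.

(** For [x] in [S], a short step from [x] towards [z] stays in the open set [S],
where the Lipschitz estimate bounds the slope from below; convexity makes the
slope to [z] at least as large. The inequality then extends to the closure as
the preimage of the closed epigraph under [w |-> (w, r + l * `|z - w|)]. *)
Lemma lipschitz_slope_lower f S l x z (r : R) :
    elsc f -> econvex f -> open S -> elipschitz l f S ->
    closure S x -> (f z <= r%:E)%E ->
  (f x <= (r + l * `|z - x|)%:E)%E.
Proof.
move=> f_lsc f_convex S_open [S_dom S_lip] Sx zr.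
pose cap (w : X) : X * R^o := (w, r + l * `|z - w|).
have cap_cont : continuous cap.
  move=> w.
  have cap2 : (r + l * `|z - v|) @[v --> w] --> (r + l * `|z - w| : R^o).
    apply: cvgD; first exact: cvg_cst.
    apply: cvgM; first exact: cvg_cst.
    by apply: cvg_norm; apply: cvgB; [exact: cvg_cst|exact: cvg_id].
  exact: cvg_pair (@cvg_id _ (nbhs w)) cap2.
suff S_cap : S `<=` cap @^-1` epigraph f.
  have /closure_id cl := (continuous_closedP cap).1 cap_cont _ f_lsc.
  have := closure_subset S_cap Sx; rewrite -cl; exact.
move=> w Sw.
have [t t_gt0 [t_le1 Sv]] :
    exists2 t : R, 0 < t & t <= 1 /\ S (w + t *: (z - w)).
  have ray_cont : continuous (fun t : R^o => w + t *: (z - w)).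
    by move=> t; apply: cvgD; [exact: cvg_cst|exact: cvgZr_tmp].
  have : nbhs (w + (0 : R) *: (z - w)) S.
    by rewrite scale0r addr0; exact: open_nbhs_nbhs.
  move=> /ray_cont/nbhs_ballP[e /= e_gt0 ball_S].
  exists (Num.min 1 (e / 2)); first by rewrite lt_min ltr01 divr_gt0.
  split; first by rewrite ge_min lexx.
  apply: ball_S; rewrite /ball/= sub0r normrN gtr0_norm.
    by rewrite gt_min; apply/orP; right; lra.
  by rewrite lt_min ltr01 divr_gt0.
have fw := fineK (S_dom _ Sw); have fv := fineK (S_dom _ Sv).
have f_w : (f w <= (fine (f w))%:E)%E by rewrite fw.
have := econvex_le f_convex (ltW t_gt0) t_le1 zr f_w.
rewrite -fv lee_fin => f_le.
have := S_lip (_, _) (conj Sv Sw).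
rewrite /= addrAC subrr add0r normrZ gtr0_norm//.
rewrite distrC => /(le_trans (ler_norm _)) f_ge.
rewrite /epigraph/= -fw lee_fin -(ler_pM2l t_gt0); lra.
Qed.

(** The cone of the support lemma consists of the positive multiples of the
vectors from [(x, f x)] to the points of the epigraph. *)
Lemma lipschitz_closure_subgradient f S l x :
    (forall y, f y != -oo%E) -> elsc f -> econvex f -> 0 <= l ->
    open S -> elipschitz l f S -> closure S x -> edom f x ->
  subdifferential f x `&` dual_ball l !=set0.
Proof.
move=> f_gtNy f_lsc f_convex l_ge0 S_open f_lip Sx fx_fin.
have fx := fineK fx_fin.
pose K : set (X * R) := [set u | exists (s : R) z (r : R),
  [/\ 0 < s, (f z <= r%:E)%E & u = (s *: (z - x), s * (r - fine (f x)))]].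
have [||||phi phi_l phi_K] := @convex_cone_supported _ _ K l l_ge0.
- exists 1, x, (fine (f x)); split=> //; first by rewrite fx.
  by rewrite !subrr scaler0 mulr0.
- move=> _ _ [s [z [r [s_gt0 zr ->]]]] [t [y [q [t_gt0 yq ->]]]] /=.
  have st_gt0 : 0 < s + t by rewrite addr_gt0.
  (* The barycentre with weight [s / (s + t)] of the two epigraph points, scaled
     by [s + t], gives the sum of the two vectors of the cone. *)
  pose m := s / (s + t).
  have m_st : (s + t) * m = s by rewrite /m mulrCA mulfV ?mulr1// gt_eqF.
  exists (s + t), (y + m *: (z - y)), (q + m * (r - q)); split=> //.
    apply: econvex_le zr yq => //; first by rewrite divr_ge0// ltW.
    by rewrite ler_pdivrMr// mul1r lerDl ltW.
  congr pair; last first.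
    transitivity ((s + t) * (q - fine (f x)) + (s + t) * m * (r - q));
      last by ring.
    by rewrite m_st; ring.
  rewrite addrAC [RHS]scalerDr scalerA m_st [in RHS]scalerDl addrAC -scalerDr.
  by rewrite [y - x + _]addrC subrKA.
- move=> c _ c_gt0 [s [z [r [s_gt0 zr ->]]]] /=.
  by exists (c * s), z, r; rewrite mulr_gt0// scalerA mulrA.
- move=> _ [s [z [r [s_gt0 zr ->]]]] /=.
  have := lipschitz_slope_lower f_lsc f_convex S_open f_lip Sx zr.
  rewrite -fx lee_fin normrZ gtr0_norm// => fxr.
  by rewrite mulrCA -mulrN ler_pM2l// lerBrDl addrC; lra.
exists phi; split=> //; split=> [|y]; first exact: fx_fin.
have [y_dom|] := boolP (f y \is a fin_num); last first.
  by rewrite fin_numE f_gtNy /= negbK => /eqP ->; rewrite -fx leey.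
rewrite -fx -(fineK y_dom) -EFinB lee_fin.
have : K (y - x, fine (f y) - fine (f x)).
  exists 1, y, (fine (f y)); rewrite scale1r mul1r.
  by split=> //; rewrite fineK.
exact: phi_K.
Qed.

End convex.

Theorem theorem4p1 (R : realType) (X : completeNormedModType R)
    (f : X -> \bar R) (l : R) (S : set X)
    (f_gtNy : forall x, f x != -oo%E)
    (f_proper : eproper f) (f_lsc : elsc f) (f_convex : econvex f)
    (l_ge0 : 0 <= l) (S_neq0 : S !=set0) (S_dom : closure S `<=` edom f) :
  let a := forall x, boundary S x ->
             subdifferential f x `&` dual_ball l !=set0 in
  let b := elipschitz l f S in
  (bounded_set S -> a -> b) /\ (open S -> b -> a).
Proof.
move=> a b; split=> [S_bnd sub_l|S_open f_lip x [Sx _]]; last first.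
  exact: lipschitz_closure_subgradient S_open f_lip Sx (S_dom _ Sx).
split=> [x Sx|[x y] [/= Sx Sy]]; first exact/S_dom/subset_closure.
have bound := boundary_subgradients_bound f_convex S_dom S_bnd sub_l.
by rewrite ler_norml lerNl opprB bound// distrC bound.
Qed.
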